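(* Let $\mathfrak{p}$ be a prime ideal of a commutative ring $R$. Then the Grothendieck group of the multiplicative monoid $R\setminus\mathfrak{p}$ is canonically isomorphic to $(R_{\mathfrak{p}})^{\ast}=R_{\mathfrak{p}}\setminus\mathfrak{p}R_{\mathfrak{p}}$.
   Context: All rings are commutative. $A^{\ast}$ denotes the group of units of a ring $A$, and $R_{\mathfrak{p}}$ is the localization of $R$ at $R\setminus\mathfrak{p}$. The Grothendieck group of a (multiplicatively written) commutative monoid $N$ is the set of equivalence classes $[s,t]$ of pairs $(s,t)\in N\times N$ under $(s,t)\sim(s',t')$ iff there is $u\in N$ with $st'u=ts'u$, with operation $[s,t]\cdot[s',t']=[ss',tt']$. The canonical map sends $[s,t]$ to $s/t\in R_{\mathfrak{p}}$. *)

(* Defs.v *)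
From HB Require Import structures.
From mathcomp Require Import all_boot all_algebra.
From mathcomp Require Import ring.
From mathcomp Require Import boolp classical_sets.

Set Implicit Arguments.
Unset Strict Implicit.
Unset Printing Implicit Defensive.

Import GRing.Theory.
Local Open Scope ring_scope.
Local Open Scope quotient_scope.

HB.mixin Record Monoid_isCommutative (N : Type) of monoid.Monoid N := {
  mulgC : commutative (@monoid.mul N)
}.

#[short(type="comMonoidType")]
HB.structure Definition ComMonoid :=
  {N of monoid.Monoid N & Monoid_isCommutative N}.

Section Grothendieck.
Variable N : comMonoidType.
Local Open Scope group_scope.

Definition groth_rel (x y : N * N) : bool :=
  `[< exists u : N, x.1 * y.2 * u = x.2 * y.1 * u >].

Let mulgCA : left_commutative (@monoid.mul N).
Proof. by move=> a b c; rewrite !mulgA (mulgC a). Qed.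

Let mulgAC : right_commutative (@monoid.mul N).
Proof. by move=> a b c; rewrite -!mulgA (mulgC b). Qed.

Let mulgACA (a b c d : N) : a * b * (c * d) = a * c * (b * d).
Proof. by rewrite -!mulgA (mulgCA b). Qed.

Fact groth_rel_equiv : equiv_class_of groth_rel.
Proof.
split=> [x|x y|y x z].
- by apply/asboolP; exists 1; rewrite (mulgC x.1).
- by apply/asboolP/asboolP => -[u e]; exists u;
    rewrite [X in X * u]mulgC -e [X in X * u]mulgC.
- move=> /asboolP[u e] /asboolP[v f]; apply/asboolP.
  exists ((y.2 * u) * (y.1 * v)).
  rewrite mulgACA (mulgCA z.2) (mulgA x.1) (mulgA y.1) e f.
  rewrite -!mulgA; congr (_ * _).
  rewrite (mulgCA y.2 z.1) (mulgCA u z.1) (mulgCA y.1 z.1); congr (_ * _).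
  by rewrite (mulgCA u y.2 v) (mulgCA y.1 y.2) (mulgCA y.1 u).
Qed.

Canonical groth_equiv := EquivRelPack groth_rel_equiv.
Canonical groth_encModRel := defaultEncModRel groth_rel.

Definition groth : Type := {eq_quot groth_rel}.
HB.instance Definition _ : EqQuotient _ groth_rel groth := EqQuotient.on groth.
HB.instance Definition _ := Choice.on groth.

Definition groth_class (s t : N) : groth := \pi_groth (s, t).

Fact groth_classP s t s' t' :
  groth_class s t = groth_class s' t' <-> exists u, s * t' * u = t * s' * u.
Proof. by split=> [/eqquotP/asboolP|?] //; apply/eqquotP/asboolP. Qed.

Fact groth_ind (P : groth -> Prop) :
  (forall s t, P (groth_class s t)) -> forall g, P g.
Proof.
by move=> h g; rewrite -[g]reprK; case: (repr g) => s t; apply: h.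
Qed.

Definition groth_one : groth := groth_class 1 1.
Definition groth_mul (g h : groth) : groth :=
  groth_class ((repr g).1 * (repr h).1) ((repr g).2 * (repr h).2).
Definition groth_inv (g : groth) : groth := groth_class (repr g).2 (repr g).1.

Let repr_class s t :
  exists u, (repr (groth_class s t)).1 * t * u
          = (repr (groth_class s t)).2 * s * u.
Proof.
apply/groth_classP; rewrite -[RHS]reprK.
by case: (repr (groth_class s t)).
Qed.

Fact groth_mulE s t s' t' :
  groth_mul (groth_class s t) (groth_class s' t')
  = groth_class (s * s') (t * t').
Proof.
have [u e] := repr_class s t; have [v f] := repr_class s' t'.
by apply/groth_classP; exists (u * v); rewrite !(mulgACA _ _ t) !(mulgACA _ _ s)
  !(mulgACA _ _ u) e f.
Qed.

Fact groth_invE s t : groth_inv (groth_class s t) = groth_class t s.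
Proof.
by have [u e] := repr_class s t; apply/groth_classP; exists u; rewrite e.
Qed.

Fact groth_mulA : associative groth_mul.
Proof.
elim/groth_ind=> a b; elim/groth_ind=> c d; elim/groth_ind=> e f.
by rewrite !groth_mulE !mulgA.
Qed.

Fact groth_mulC : commutative groth_mul.
Proof.
elim/groth_ind=> a b; elim/groth_ind=> c d.
by rewrite !groth_mulE (mulgC a) (mulgC b).
Qed.

Fact groth_mul1 : left_id groth_one groth_mul.
Proof. by elim/groth_ind=> a b; rewrite groth_mulE !mul1g. Qed.

Fact groth_mulV : left_inverse groth_one groth_inv groth_mul.
Proof.
elim/groth_ind=> a b; rewrite groth_invE groth_mulE.
by apply/groth_classP; exists 1; rewrite (mulgC b).
Qed.

HB.instance Definition _ := monoid.isGroup.Build groth groth_mulA groth_mul1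
  (fun g => etrans (groth_mulC g _) (groth_mul1 g)) groth_mulV
  (fun g => etrans (groth_mulC g _) (groth_mulV g)).

HB.instance Definition _ := Monoid_isCommutative.Build groth groth_mulC.

Fact groth_classM s t s' t' :
  groth_class s t * groth_class s' t' = groth_class (s * s') (t * t').
Proof. exact: groth_mulE. Qed.

End Grothendieck.

Section PrimeComplement.
Variables (R : comNzRingType) (p : prime_idealr R).

Definition prime_compl : Type := {x : R | x \notin (p : pred R)}.
HB.instance Definition _ :=
  SubChoice.copy prime_compl {x : R | x \notin (p : pred R)}.
Implicit Types s t u : prime_compl.

Fact prime_compl1 : 1 \notin (p : pred R).
Proof. by rewrite idealr1. Qed.

Fact prime_complM s t : val s * val t \notin (p : pred R).
Proof. by rewrite prime_idealrM negb_or (valP s) (valP t). Qed.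

Definition pc_one : prime_compl := Sub 1 prime_compl1.
Definition pc_mul s t : prime_compl := Sub (val s * val t) (prime_complM s t).

Fact pc_mulA : associative pc_mul.
Proof. by move=> s t u; apply/val_inj; rewrite !SubK mulrA. Qed.
Fact pc_mulC : commutative pc_mul.
Proof. by move=> s t; apply/val_inj; rewrite !SubK mulrC. Qed.
Fact pc_mul1 : left_id pc_one pc_mul.
Proof. by move=> s; apply/val_inj; rewrite !SubK mul1r. Qed.

HB.instance Definition _ := monoid.isMonoid.Build prime_compl pc_mulA pc_mul1
  (fun s => etrans (pc_mulC s _) (pc_mul1 s)).
HB.instance Definition _ := Monoid_isCommutative.Build prime_compl pc_mulC.

Fact val_pc1 : val (1%g : prime_compl) = 1 :> R. Proof. by []. Qed.
Fact val_pcM s t : val (s * t)%g = val s * val t. Proof. by []. Qed.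

End PrimeComplement.

Section Localization.
Variables (R : comNzRingType) (p : prime_idealr R).
Local Notation C := (prime_compl p).

Definition loc_rel (x y : R * C) : bool :=
  `[< exists u : C, x.1 * val y.2 * val u = y.1 * val x.2 * val u >].

Fact loc_rel_equiv : equiv_class_of loc_rel.
Proof.
split=> [x|x y|y x z].
- by apply/asboolP; exists 1%g.
- by apply/asboolP/asboolP => -[u e]; exists u.
- move=> /asboolP[u e] /asboolP[v f]; apply/asboolP.
  exists (y.2 * u * v)%g; rewrite !val_pcM.
  transitivity ((x.1 * val y.2 * val u) * (val z.2 * val v)); first by ring.
  rewrite e.
  transitivity ((y.1 * val z.2 * val v) * (val x.2 * val u)); first by ring.
  by rewrite f; ring.
Qed.

Canonical loc_equiv := EquivRelPack loc_rel_equiv.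
Canonical loc_encModRel := defaultEncModRel loc_rel.

Definition localization : Type := {eq_quot loc_rel}.
HB.instance Definition _ : EqQuotient _ loc_rel localization :=
  EqQuotient.on localization.
HB.instance Definition _ := Choice.on localization.

Definition loc_frac (a : R) (s : C) : localization := \pi_localization (a, s).

Fact loc_fracP a s b t : loc_frac a s = loc_frac b t <->
  exists u : C, a * val t * val u = b * val s * val u.
Proof. by split=> [/eqquotP/asboolP|?] //; apply/eqquotP/asboolP. Qed.

Fact loc_ind (P : localization -> Prop) :
  (forall a s, P (loc_frac a s)) -> forall x, P x.
Proof.
by move=> h x; rewrite -[x]reprK; case: (repr x) => a s; apply: h.
Qed.

Definition loc_zero : localization := loc_frac 0 1%g.
Definition loc_one : localization := loc_frac 1 1%g.
Definition loc_opp (x : localization) := loc_frac (- (repr x).1) (repr x).2.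
Definition loc_add (x y : localization) :=
  loc_frac ((repr x).1 * val (repr y).2 + (repr y).1 * val (repr x).2)
       ((repr x).2 * (repr y).2)%g.
Definition loc_mul (x y : localization) :=
  loc_frac ((repr x).1 * (repr y).1) ((repr x).2 * (repr y).2)%g.

Let repr_loc_frac a s : exists u : C,
  (repr (loc_frac a s)).1 * val s * val u = a * val (repr (loc_frac a s)).2 * val u.
Proof.
by apply/loc_fracP; rewrite -[RHS]reprK; case: (repr (loc_frac a s)).
Qed.

Fact loc_oppE a s : loc_opp (loc_frac a s) = loc_frac (- a) s.
Proof.
have [u e] := repr_loc_frac a s; apply/loc_fracP; exists u.
by rewrite !mulNr e.
Qed.

Fact loc_addE a s b t : loc_add (loc_frac a s) (loc_frac b t)
  = loc_frac (a * val t + b * val s) (s * t)%g.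
Proof.
rewrite /loc_add; have [u e] := repr_loc_frac a s; have [v f] := repr_loc_frac b t.
case: (repr (loc_frac a s)) e => a' s'; rewrite /fst /snd => e.
case: (repr (loc_frac b t)) f => b' t'; rewrite /fst /snd => f.
apply/loc_fracP; exists (u * v)%g; rewrite !val_pcM.
transitivity ((a' * val s * val u) * (val t' * val t * val v)
  + (b' * val t * val v) * (val s' * val s * val u)); first by ring.
by rewrite e f; ring.
Qed.

Fact loc_mulE a s b t :
  loc_mul (loc_frac a s) (loc_frac b t) = loc_frac (a * b) (s * t)%g.
Proof.
rewrite /loc_mul; have [u e] := repr_loc_frac a s; have [v f] := repr_loc_frac b t.
case: (repr (loc_frac a s)) e => a' s'; rewrite /fst /snd => e.
case: (repr (loc_frac b t)) f => b' t'; rewrite /fst /snd => f.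
apply/loc_fracP; exists (u * v)%g; rewrite !val_pcM.
transitivity ((a' * val s * val u) * (b' * val t * val v)); first by ring.
by rewrite e f; ring.
Qed.

Let loc_frac_eq a s b t : a * val t = b * val s -> loc_frac a s = loc_frac b t.
Proof. by move=> e; apply/loc_fracP; exists 1%g; rewrite e. Qed.

Fact loc_addA : associative loc_add.
Proof.
elim/loc_ind=> a s; elim/loc_ind=> b t; elim/loc_ind=> c u.
by rewrite !loc_addE; apply: loc_frac_eq; rewrite !val_pcM; ring.
Qed.

Fact loc_addC : commutative loc_add.
Proof.
elim/loc_ind=> a s; elim/loc_ind=> b t.
by rewrite !loc_addE; apply: loc_frac_eq; rewrite !val_pcM; ring.
Qed.

Fact loc_add0 : left_id loc_zero loc_add.
Proof.
elim/loc_ind=> a s; rewrite loc_addE; apply: loc_frac_eq.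
by rewrite !val_pcM val_pc1; ring.
Qed.

Fact loc_addN : left_inverse loc_zero loc_opp loc_add.
Proof.
elim/loc_ind=> a s; rewrite loc_oppE loc_addE; apply: loc_frac_eq.
by rewrite !val_pcM val_pc1; ring.
Qed.

HB.instance Definition _ := GRing.isZmodule.Build localization
  loc_addA loc_addC loc_add0 loc_addN.

Fact loc_mulA : associative loc_mul.
Proof.
elim/loc_ind=> a s; elim/loc_ind=> b t; elim/loc_ind=> c u.
by rewrite !loc_mulE; apply: loc_frac_eq; rewrite !val_pcM; ring.
Qed.

Fact loc_mulC : commutative loc_mul.
Proof.
elim/loc_ind=> a s; elim/loc_ind=> b t.
by rewrite !loc_mulE; apply: loc_frac_eq; rewrite !val_pcM; ring.
Qed.

Fact loc_mul1 : left_id loc_one loc_mul.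
Proof.
elim/loc_ind=> a s; rewrite loc_mulE; apply: loc_frac_eq.
by rewrite !val_pcM val_pc1; ring.
Qed.

Fact loc_mulDl : left_distributive loc_mul loc_add.
Proof.
elim/loc_ind=> a s; elim/loc_ind=> b t; elim/loc_ind=> c u.
rewrite loc_addE !loc_mulE loc_addE; apply: loc_frac_eq.
by rewrite !val_pcM; ring.
Qed.

Fact loc_one_neq0 : loc_one != loc_zero.
Proof.
apply/eqP => /loc_fracP[u]; rewrite val_pc1 !mul1r !mul0r => u0.
by have := valP u; rewrite u0 idealr0.
Qed.

HB.instance Definition _ := GRing.Zmodule_isComNzRing.Build localization
  loc_mulA loc_mulC loc_mul1 loc_mulDl loc_one_neq0.

Fact loc_fracD a s b t :
  loc_frac a s + loc_frac b t = loc_frac (a * val t + b * val s) (s * t)%g.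
Proof. exact: loc_addE. Qed.

Fact loc_fracM a s b t : loc_frac a s * loc_frac b t = loc_frac (a * b) (s * t)%g.
Proof. exact: loc_mulE. Qed.

Definition loc_unit : {pred localization} :=
  fun x => `[< exists y, y * x = 1 >].
Definition loc_inv (x : localization) : localization :=
  xget x [set y | y * x = 1]%classic.

Fact loc_mulVx : {in loc_unit, left_inverse 1 loc_inv *%R}.
Proof.
move=> x /asboolP[y yx]; rewrite /loc_inv.
by case: xgetP => [z _ //|/(_ y)].
Qed.

Fact loc_unitPl (x y : localization) : y * x = 1 -> loc_unit x.
Proof. by move=> yx; apply/asboolP; exists y. Qed.

Fact loc_inv_out : {in [predC loc_unit], loc_inv =1 id}.
Proof.
move=> x /asboolPn nx; rewrite /loc_inv.
by case: xgetP => [y _ yx|//]; case: nx; exists y.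
Qed.

HB.instance Definition _ := GRing.ComNzRing_hasMulInverse.Build localization
  loc_mulVx loc_unitPl loc_inv_out.

Definition loc_map (a : R) : localization := loc_frac a 1%g.

Fact loc_map_zmod : zmod_morphism loc_map.
Proof.
move=> a b; rewrite /loc_map.
have -> : - loc_frac b 1%g = loc_frac (- b) 1%g by exact: loc_oppE.
by rewrite loc_fracD; apply: loc_frac_eq; rewrite !val_pcM val_pc1; ring.
Qed.

Fact loc_map_monoid : monoid_morphism loc_map.
Proof.
split=> // a b.
by rewrite loc_fracM; apply: loc_frac_eq; rewrite !val_pcM val_pc1; ring.
Qed.

HB.instance Definition _ :=
  GRing.isZmodMorphism.Build R localization loc_map loc_map_zmod.
HB.instance Definition _ :=
  GRing.isMonoidMorphism.Build R localization loc_map loc_map_monoid.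

End Localization.

(* MathComp's [{unit A}] exists only for finite rings. *)
Section UnitGroup.
Variable A : comUnitRingType.

Definition unit_group : Type := {x : A | x \is a GRing.unit}.
HB.instance Definition _ :=
  SubChoice.copy unit_group {x : A | x \is a GRing.unit}.
Implicit Types x y z : unit_group.

Fact ug_mulP x y : val x * val y \is a GRing.unit.
Proof. by rewrite unitrM (valP x) (valP y). Qed.
Fact ug_invP x : (val x)^-1 \is a GRing.unit.
Proof. by rewrite unitrV (valP x). Qed.

Definition ug_one : unit_group := Sub 1 (unitr1 A).
Definition ug_mul x y : unit_group := Sub (val x * val y) (ug_mulP x y).
Definition ug_inv x : unit_group := Sub (val x)^-1 (ug_invP x).

Fact ug_mulA : associative ug_mul.
Proof. by move=> x y z; apply/val_inj; rewrite !SubK mulrA. Qed.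
Fact ug_mulC : commutative ug_mul.
Proof. by move=> x y; apply/val_inj; rewrite !SubK mulrC. Qed.
Fact ug_mul1 : left_id ug_one ug_mul.
Proof. by move=> x; apply/val_inj; rewrite !SubK mul1r. Qed.
Fact ug_mulV : left_inverse ug_one ug_inv ug_mul.
Proof. by move=> x; apply/val_inj; rewrite !SubK mulVr //; apply: (valP x). Qed.

HB.instance Definition _ := monoid.isGroup.Build unit_group ug_mulA ug_mul1
  (fun x => etrans (ug_mulC x _) (ug_mul1 x)) ug_mulV
  (fun x => etrans (ug_mulC x _) (ug_mulV x)).
HB.instance Definition _ := Monoid_isCommutative.Build unit_group ug_mulC.

End UnitGroup.

Definition ideal_gen (A : comNzRingType) (X : set A) : set A :=
  [set x | exists n (c g : 'I_n -> A),
     (forall i, X (g i)) /\ x = \sum_(i < n) c i * g i]%classic.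

Definition ideal_ext (A B : comNzRingType) (f : {rmorphism A -> B})
  (I : {pred A}) : set B := ideal_gen (f @` [set` I])%classic.

(* Main.v *)
Require Import Defs.
From HB Require Import structures.
From mathcomp Require Import all_boot all_algebra.
From mathcomp Require Import ring.
From mathcomp Require Import boolp classical_sets.
Import GRing.Theory.
Local Open Scope ring_scope.
Local Open Scope classical_set_scope.

(** A fraction [a / s] is a unit of the local ring exactly when [a] lies outside
    [p], and it lies in the extended ideal exactly when [a] lies in [p]; both
    conditions are independent of the representative because [p] is prime.
    Hence the units are the complement of the extended ideal, and they are the
    fractions [s / t] with [s] and [t] outside [p].  For such fractions, equality
    in the localization is the relation defining the Grothendieck group. *)

Section LocalizationAtPrime.
Variables (R : comNzRingType) (p : prime_idealr R).
Local Notation P := (p : pred R).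
Local Notation C := (prime_compl p).
Implicit Types (a b : R) (s t : C).

Lemma prime_compl_mulr a s : (a * val s \in P) = (a \in P).
Proof. by rewrite prime_idealrM (negbTE (valP s)) orbF. Qed.

(** Cross-multiplication scales each numerator only by elements outside [p], which
    [prime_compl_mulr] cancels. *)
Lemma loc_frac_eq_mem a s b t :
  loc_frac a s = loc_frac b t -> (a \in P) = (b \in P).
Proof.
case/loc_fracP=> u /(congr1 (fun x => x \in P)).
by rewrite !prime_compl_mulr.
Qed.

Lemma loc_frac_unit a s : (loc_frac a s \is a GRing.unit) = (a \notin P).
Proof.
apply/unitrP/idP => [[y [+ _]]|aP].
  elim/loc_ind: y => b t; rewrite loc_fracM => /loc_frac_eq_mem.
  by rewrite idealr1 prime_idealrM => /negbT /norP[].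
(* As [a] lies outside [p], it is an admissible denominator, so [s / a] can serve as the inverse. *)
suff e : loc_frac (val s) (Sub a aP : C) * loc_frac a s = 1.
  by exists (loc_frac (val s) (Sub a aP : C)); split=> //; rewrite mulrC.
rewrite loc_fracM; apply/loc_fracP; exists 1%g.
by rewrite !val_pcM val_pc1 SubK; ring.
Qed.

Lemma ideal_ext_frac a s :
  ideal_ext (@loc_map R p) P (loc_frac a s) <-> a \in P.
Proof.
split=> [[n [c [g [gP e]]]]|aP]; last first.
  (* A one-term combination: [a / s = (1 / s) * (a / 1)]. *)
  exists 1%N, (fun=> loc_frac 1 s), (fun=> loc_map p a).
  split=> [_|]; first by exists a.
  by rewrite big_ord1 loc_fracM mul1r mulg1.
(* Having some representative with numerator in [p] survives sums; [loc_frac_eq_mem] then carries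
   membership over to [a]. *)
suff [b [t [bP]]] : exists b t, b \in P /\
    \sum_(i < n) c i * g i = loc_frac b t.
  by rewrite -e => /loc_frac_eq_mem ->.
elim/big_ind: _ => [|x y [b [t [bP ->]]] [b' [t' [bP' ->]]]|i _].
- by exists 0, 1%g; rewrite idealr0.
- exists (b * val t' + b' * val t), (t * t')%g; rewrite loc_fracD.
  by rewrite rpredD // prime_compl_mulr.
- have [b bP <-] := gP i; elim/loc_ind: (c i) => d t.
  exists (d * b), (t * 1)%g; rewrite loc_fracM; split=> //.
  by rewrite prime_idealrM bP orbT.
Qed.

Lemma loc_unit_setE :
  [set` (@GRing.unit (localization p))] =
    [set: localization p] `\` ideal_ext (@loc_map R p) P.
Proof.
rewrite setTD; apply/seteqP; split; elim/loc_ind=> a s /=.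
  by rewrite loc_frac_unit => aP /ideal_ext_frac; apply/negP.
by move=> nI; rewrite loc_frac_unit; apply/negP => /(ideal_ext_frac a s).
Qed.

Fact groth_frac_unit (g : groth C) :
  loc_frac (val (repr g).1) (repr g).2 \is a GRing.unit.
Proof. by rewrite loc_frac_unit (valP (repr g).1). Qed.

Definition groth_to_units (g : groth C) : unit_group (localization p) :=
  Sub (loc_frac (val (repr g).1) (repr g).2) (groth_frac_unit g).

(** The two relations differ only by commuting one product. Left to right gives independence of the
    representative, right to left injectivity. *)
Lemma groth_class_eq_frac (s t s' t' : C) :
  groth_class s t = groth_class s' t' <->
  loc_frac (val s) t = loc_frac (val s') t'.
Proof.
split=> [/groth_classP[u] e|/loc_fracP[u] e].
  apply/loc_fracP; exists u; rewrite [val s' * _]mulrC.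
  exact: (congr1 val e).
apply/groth_classP; exists u; apply/val_inj.
by rewrite !val_pcM e [val s' * _]mulrC.
Qed.

Lemma groth_to_unitsE s t :
  val (groth_to_units (groth_class s t)) = loc_frac (val s) t.
Proof.
rewrite SubK; apply/groth_class_eq_frac.
by rewrite -[RHS]reprK; case: (repr (groth_class s t)).
Qed.

Fact groth_to_unitsM : {morph groth_to_units : g h / (g * h)%g}.
Proof.
elim/groth_ind=> s t; elim/groth_ind=> s' t'; apply/val_inj.
(* The product of units is, by computation, the product of the underlying fractions. *)
rewrite [RHS](_ : _ = val (groth_to_units (groth_class s t)) *
  val (groth_to_units (groth_class s' t'))) //.
by rewrite groth_classM !groth_to_unitsE loc_fracM.
Qed.

HB.instance Definition _ := monoid.isMultiplicative.Build
  (groth C) (unit_group (localization p)) groth_to_units groth_to_unitsM.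

Lemma groth_to_units_inj : injective groth_to_units.
Proof.
elim/groth_ind=> s t; elim/groth_ind=> s' t' /(congr1 val).
by rewrite !groth_to_unitsE => /groth_class_eq_frac.
Qed.

Lemma groth_to_units_surj (x : unit_group (localization p)) :
  exists g, groth_to_units g = x.
Proof.
(* Being a unit puts the numerator outside [p], so [a] itself is an element of the monoid. *)
case: x => x; elim/loc_ind: x => a s xU; have := xU; rewrite loc_frac_unit => aP.
by exists (groth_class (Sub a aP : C) s); apply/val_inj; rewrite groth_to_unitsE.
Qed.

Lemma groth_to_units_bij : bijective groth_to_units.
Proof.
(* Choice yields a right inverse; injectivity makes it two-sided. *)
have [h hK] := choice groth_to_units_surj.
by exists h => // g; apply: groth_to_units_inj; rewrite hK.
Qed.

End LocalizationAtPrime.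

Theorem corollary4p5 (R : comNzRingType) (p : prime_idealr R) :
  (exists f : {multiplicative groth (prime_compl p) ->
                              unit_group (localization p)},
     bijective f /\
     forall s t : prime_compl p, val (f (groth_class s t)) = loc_frac (val s) t) /\
  [set` (@GRing.unit (localization p))] =
    [set: localization p] `\` ideal_ext (@loc_map R p) (p : pred R).
Proof.
split; last exact: loc_unit_setE.
exists (@groth_to_units R p : {multiplicative _ -> _}).
by split; [exact: groth_to_units_bij | exact: groth_to_unitsE].
Qed.
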